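(* Let $\mathbb{L},\mathbb{S}\in\mathbb{C}^{N\times N}$ be the Loewner and shifted Loewner matrices associated with the right data $(\lambda_k,\mathbf{r}_k,\mathbf{w}_k)_{k=1}^N$ and the left data $(\mu_h,\ell_h,\mathbf{v}_h)_{h=1}^N$, satisfying the Sylvester equations $$M\mathbb{L}-\mathbb{L}\Lambda=\mathbf{V}\mathbf{R}-\mathbf{L}\mathbf{W},\qquad M\mathbb{S}-\mathbb{S}\Lambda=M\mathbf{V}\mathbf{R}-\mathbf{L}\mathbf{W}\Lambda .$$ Then $$\mathbb{L}=\sum_{j=1}^q \operatorname{diag}(\widetilde{\mathbf{v}}_j)\,\mathcal{C}\,\operatorname{diag}(\widetilde{\mathbf{r}}_j^{*})-\sum_{j=1}^p \operatorname{diag}(\widetilde\ell_j)\,\mathcal{C}\,\operatorname{diag}(\widetilde{\mathbf{w}}_j^{*})$$ and $$\mathbb{S}=\sum_{j=1}^q \operatorname{diag}(M\widetilde{\mathbf{v}}_j)\,\mathcal{C}\,\operatorname{diag}(\widetilde{\mathbf{r}}_j^{*})-\sum_{j=1}^p \operatorname{diag}(\widetilde\ell_j)\,\mathcal{C}\,\operatorname{diag}(\Lambda^{*}\widetilde{\mathbf{w}}_j^{*}),$$ where $\mathcal{C}\in\mathbb{C}^{N\times N}$ denotes the Cauchy matrix with entries $\mathcal{C}_{hk}=\frac{1}{\mu_h-\lambda_k}$, $h,k=1,\dots,N$; the vectors $\widetilde{\mathbf{v}}_j\in\mathbb{C}^N$ and $\widetilde\ell_j\in\mathbb{C}^N$ denote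 the $j$-th columns of $\mathbf{V}$ and $\mathbf{L}$, respectively, so that $\mathbf{V}=[\widetilde{\mathbf{v}}_1,\dots,\widetilde{\mathbf{v}}_q]$ and $\mathbf{L}=[\widetilde\ell_1,\dots,\widetilde\ell_p]$; and the vectors $\widetilde{\mathbf{r}}_j\in\mathbb{C}^{1\times N}$ and $\widetilde{\mathbf{w}}_j\in\mathbb{C}^{1\times N}$ are the $j$-th rows of $\mathbf{R}$ (rows $\widetilde{\mathbf{r}}_1,\dots,\widetilde{\mathbf{r}}_q$) and $\mathbf{W}$ (rows $\widetilde{\mathbf{w}}_1,\dots,\widetilde{\mathbf{w}}_p$), respectively.
   Context: Setting (Loewner framework). Given are real frequencies $f_j$, $j=1,\dots,N$, with $\omega_j=2\pi f_j$, and measurements $\mathbf{H}_j\in\mathbb{C}^{p\times q}$ at the points $\mathrm{i}\omega_j$; the data are completed by complex conjugation, i.e. the measurement at $-\mathrm{i}\omega_j$ is $\overline{\mathbf{H}}_j$. The points $\pm\mathrm{i}\omega_j$ are partitioned into two disjoint sets: the right points $\lambda_1,\dots,\lambda_N$ and the left points $\mu_1,\dots,\mu_N$. Right tangential directions are column vectors $\mathbf{r}_k\in\mathbb{C}^q$, and the right vector data $\mathbf{w}_k\in\mathbb{C}^p$ equal the measurement at $\lambda_k$ times $\mathbf{r}_k$. Left tangential directions are row vectors $\ell_h\in\mathbb{C}^{1\times p}$, and the left vector data $\mathbf{v}_h\in\mathbb{C}^{1\times q}$ equal $\ell_h$ times the measurement at $\mu_h$. The Loewner and shifted Loewner matrices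 are defined entrywise by $$\mathbb{L}_{hk}=\frac{\mathbf{v}_h\mathbf{r}_k-\ell_h\mathbf{w}_k}{\mu_h-\lambda_k},\qquad \mathbb{S}_{hk}=\frac{\mu_h\mathbf{v}_h\mathbf{r}_k-\lambda_k\ell_h\mathbf{w}_k}{\mu_h-\lambda_k},\qquad h,k=1,\dots,N.$$ Data matrices: $\Lambda=\operatorname{diag}(\lambda_1,\dots,\lambda_N)$, $M=\operatorname{diag}(\mu_1,\dots,\mu_N)$; $\mathbf{R}=[\mathbf{r}_1,\dots,\mathbf{r}_N]\in\mathbb{C}^{q\times N}$, $\mathbf{W}=[\mathbf{w}_1,\dots,\mathbf{w}_N]\in\mathbb{C}^{p\times N}$ (columns $\mathbf{r}_k$, $\mathbf{w}_k$); $\mathbf{L}\in\mathbb{C}^{N\times p}$ has rows $\ell_1,\dots,\ell_N$ and $\mathbf{V}\in\mathbb{C}^{N\times q}$ has rows $\mathbf{v}_1,\dots,\mathbf{v}_N$. For a vector $\mathbf{x}\in\mathbb{C}^N$, $\operatorname{diag}(\mathbf{x})$ is the diagonal matrix with diagonal $\mathbf{x}$; $^*$ denotes the complex conjugate transpose.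
   Formalization: The stars on r̃_j, w̃_j and Λ in the right-hand diagonal factors are read as plain transpose, not conjugate transpose; with conjugation the formulas are false (N=p=q=1, H=i, r=ℓ=1, λ=2πi, μ=−2πi gives 𝕃=1/(2π) but right side 0). *)

(* Defs.v *)
From HB Require Import structures.
From mathcomp Require Import all_boot all_order all_algebra.
From mathcomp Require Import complex.
From mathcomp Require Import reals trigo.

Set Implicit Arguments.
Unset Strict Implicit.
Unset Printing Implicit Defensive.

Import Order.TTheory GRing.Theory Num.Theory.

Local Open Scope ring_scope.
Local Open Scope complex_scope.

(* The 2N data points and measurements are labelled by 'I_N * bool: the label
   (j, false) stands for i w_j with measurement H_j, and (j, true) for - i w_j
   with the conjugate measurement, where w_j = 2 pi f_j. *)
Definition data_point (R : realType) (N : nat) (f : 'I_N -> R)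
    (s : 'I_N * bool) : R[i] :=
  let omega := 2 * pi * f s.1 in
  if s.2 then 0 -i* omega else 0 +i* omega.

Definition measurement (R : realType) (N p q : nat) (H : 'I_N -> 'M[R[i]]_(p, q))
    (s : 'I_N * bool) : 'M[R[i]]_(p, q) :=
  if s.2 then map_mx (fun z => z^*) (H s.1) else H s.1.

(* rho k and sigma h are the labels of the k-th right and of the h-th left
   point.  The last clause asks that no point, as a complex number, be both a
   right and a left point, so that the denominators mu_h - lambda_k are
   nonzero. *)
Definition point_partition (R : realType) (N : nat) (f : 'I_N -> R)
    (rho sigma : 'I_N -> 'I_N * bool) : Prop :=
  [/\ injective rho,
      injective sigma,
      forall s, (exists k, rho k = s) \/ (exists h, sigma h = s)
    & forall h k, data_point f (sigma h) <> data_point f (rho k)].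

Definition loewner_mx (R : realType) (N p q : nat)
    (lambda : 'I_N -> R[i]) (r : 'I_N -> 'cV[R[i]]_q) (w : 'I_N -> 'cV[R[i]]_p)
    (mu : 'I_N -> R[i]) (l : 'I_N -> 'rV[R[i]]_p) (v : 'I_N -> 'rV[R[i]]_q) :
    'M[R[i]]_N :=
  \matrix_(h, k)
    (((v h *m r k) 0 0 - (l h *m w k) 0 0) / (mu h - lambda k)).

Definition shifted_loewner_mx (R : realType) (N p q : nat)
    (lambda : 'I_N -> R[i]) (r : 'I_N -> 'cV[R[i]]_q) (w : 'I_N -> 'cV[R[i]]_p)
    (mu : 'I_N -> R[i]) (l : 'I_N -> 'rV[R[i]]_p) (v : 'I_N -> 'rV[R[i]]_q) :
    'M[R[i]]_N :=
  \matrix_(h, k)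
    ((mu h * (v h *m r k) 0 0 - lambda k * (l h *m w k) 0 0)
     / (mu h - lambda k)).

Definition cauchy_mx (R : realType) (N : nat) (lambda mu : 'I_N -> R[i]) :
    'M[R[i]]_N :=
  \matrix_(h, k) (mu h - lambda k)^-1.

Definition cols_mx (R : realType) (m N : nat) (x : 'I_N -> 'cV[R[i]]_m) :
    'M[R[i]]_(m, N) :=
  \matrix_(a, k) x k a 0.

Definition rows_mx (R : realType) (m N : nat) (x : 'I_N -> 'rV[R[i]]_m) :
    'M[R[i]]_(N, m) :=
  \matrix_(h, b) x h 0 b.

(* diag_mx expects a row vector, whereas x in diag(x) is a column here.  When
   the diagonal comes from a row y of a data matrix, x is the plain transpose
   y^T, not the conjugate transpose: M X - X Lambda = x y has the solution
   X_hk = x_h y_k / (mu_h - lambda_k), in which y_k is not conjugated. *)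
Definition diagc (R : realType) (N : nat) (x : 'cV[R[i]]_N) : 'M[R[i]]_N :=
  diag_mx x^T.

(* Main.v *)
Require Import Defs.
From HB Require Import structures.
From mathcomp Require Import all_boot all_order all_algebra.
From mathcomp Require Import complex.
From mathcomp Require Import reals trigo.

Set Implicit Arguments.
Unset Strict Implicit.
Unset Printing Implicit Defensive.

Import Order.TTheory GRing.Theory Num.Theory.

Local Open Scope ring_scope.
Local Open Scope complex_scope.

(** Both matrices are entrywise products of the Cauchy matrix with a matrix of low rank:
    [V *m RR - L *m W] for [LL], and [M *m V *m RR - L *m W *m Lam] for [SS]. Writing each matrix
    product as a sum of outer products, column times row, turns the entrywise product into a sum of
    Cauchy matrices scaled by diagonals on both sides. [sum_diag_cauchyE] carries this; the theorem
    then compares entries. *)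

Lemma diagc_mul_diagcE (R : realType) (N : nat) (x y : 'cV[R[i]]_N)
    (C : 'M[R[i]]_N) h k :
  (diagc x *m C *m diagc y) h k = x h 0 * C h k * y k 0.
Proof. by rewrite /diagc mul_mx_diag mxE mul_diag_mx !mxE. Qed.

(** The j-th term scales the Cauchy entry by [A h j * B j k]; the common denominator factors out,
    leaving the sum over j that defines the matrix product. *)
Lemma sum_diag_cauchyE (R : realType) (N m : nat) (lambda mu : 'I_N -> R[i])
    (A : 'M[R[i]]_(N, m)) (B : 'M[R[i]]_(m, N)) h k :
  (\sum_(j < m) diagc (col j A) *m cauchy_mx lambda mu *m diagc (row j B)^T) h k
  = (A *m B) h k / (mu h - lambda k).
Proof.
rewrite summxE [(A *m B) h k]mxE mulr_suml; apply: eq_bigr => j _.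
by rewrite diagc_mul_diagcE !mxE mulrAC.
Qed.

Lemma rows_mulmx_colsE (R : realType) (N m : nat) (x : 'I_N -> 'rV[R[i]]_m)
    (y : 'I_N -> 'cV[R[i]]_m) h k :
  (rows_mx x *m cols_mx y) h k = (x h *m y k) 0 0.
Proof. by rewrite !mxE; apply: eq_bigr => j _; rewrite !mxE. Qed.

Theorem theorem1 (R : realType) (N p q : nat)
    (f : 'I_N -> R) (H : 'I_N -> 'M[R[i]]_(p, q))
    (rho sigma : 'I_N -> 'I_N * bool)
    (Hpart : point_partition f rho sigma)
    (lambda mu : 'I_N -> R[i])
    (Hlambda : forall k, lambda k = data_point f (rho k))
    (Hmu : forall h, mu h = data_point f (sigma h))
    (r : 'I_N -> 'cV[R[i]]_q) (w : 'I_N -> 'cV[R[i]]_p)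
    (Hw : forall k, w k = measurement H (rho k) *m r k)
    (l : 'I_N -> 'rV[R[i]]_p) (v : 'I_N -> 'rV[R[i]]_q)
    (Hv : forall h, v h = l h *m measurement H (sigma h))
    (LL SS : 'M[R[i]]_N)
    (HLL : LL = loewner_mx lambda r w mu l v)
    (HSS : SS = shifted_loewner_mx lambda r w mu l v) :
  let Lam : 'M[R[i]]_N := diag_mx (\row_k lambda k) in
  let M : 'M[R[i]]_N := diag_mx (\row_h mu h) in
  let RR : 'M[R[i]]_(q, N) := cols_mx r in
  let W : 'M[R[i]]_(p, N) := cols_mx w in
  let L : 'M[R[i]]_(N, p) := rows_mx l in
  let V : 'M[R[i]]_(N, q) := rows_mx v in
  let C : 'M[R[i]]_N := cauchy_mx lambda mu in
  M *m LL - LL *m Lam = V *m RR - L *m W ->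
  M *m SS - SS *m Lam = M *m V *m RR - L *m W *m Lam ->
  LL = \sum_(j < q) diagc (col j V) *m C *m diagc (row j RR)^T
       - \sum_(j < p) diagc (col j L) *m C *m diagc (row j W)^T
  /\
  SS = \sum_(j < q) diagc (M *m col j V) *m C *m diagc (row j RR)^T
       - \sum_(j < p) diagc (col j L) *m C *m diagc (Lam^T *m (row j W)^T).
Proof.
move=> Lam M RR W L V C _ _.
(* The diagonal factors are absorbed into the data matrices, so that [sum_diag_cauchyE] applies to
   [SS] with [M *m V] and [W *m Lam]. *)
have colMV j : M *m col j V = col j (M *m V) by rewrite !colE mulmxA.
have rowWLam j : Lam^T *m (row j W)^T = (row j (W *m Lam))^T.
  by rewrite -trmx_mul row_mul.
split; apply/matrixP => h k.
  rewrite HLL [LHS]mxE [RHS]mxE [X in _ = _ + X]mxE !sum_diag_cauchyE.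
  by rewrite !rows_mulmx_colsE mulrBl.
under eq_bigr do rewrite colMV.
under [X in _ - X]eq_bigr do rewrite rowWLam.
rewrite HSS [LHS]mxE [RHS]mxE [X in _ = _ + X]mxE !sum_diag_cauchyE.
(* Reassociating moves [M] and [Lam] to the outside, where they scale the entries of [V *m RR] and
   [L *m W] by [mu h] and [lambda k]. *)
rewrite -mulmxA [L *m _]mulmxA mul_diag_mx mul_mx_diag.
(* Only the outer entries are unfolded: the inner products must stay intact for
   [rows_mulmx_colsE]. *)
rewrite [X in _ = X / _ - _]mxE [X in _ = _ - X / _]mxE.
by rewrite !rows_mulmx_colsE !mxE mulrBl [_ * lambda k]mulrC.
Qed.
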